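(* Consider the optimization problem $$\inf_{x\in\mathbb{R}^n}\Big\{f(x):=\tfrac12x^TQ_0x+a_0^Tx+b_0\ :\ g_1(x):=\tfrac12x^TQ_1x+a_1^Tx+b_1\le0\Big\},$$ with $Q_0,Q_1$ symmetric $n\times n$ real matrices, $a_0,a_1\in\mathbb{R}^n$, $b_0,b_1\in\mathbb{R}$, and let $\theta(\mu)=\inf_{x\in\mathbb{R}^n}\{f(x)+\mu g_1(x)\}$ for $\mu\ge0$. Assume that $Q_0,Q_1$ are positive definite, that there exists $x_0$ such that $g_1(x_0)<0$, and that $a_0\neq Q_0Q_1^{-1}a_1$. Let $\mathcal{L}$ be any lower bound on the optimal value of the problem and let $\bar\mu=(\mathcal{L}-f(x_0))/g_1(x_0)\ge0$. Then the optimal solution of the dual problem $\max_{\mu\ge0}\theta(\mu)$ is contained in the interval $[0,\bar\mu]$, and the dual function $\theta$ is strongly concave on the interval $[0,\bar\mu]$ with constant of strong concavity $$\alpha_D=\big(Q_1^{-1/2}(a_0-Q_0Q_1^{-1}a_1)\big)^T\big(Q_1^{-1/2}Q_0Q_1^{-1/2}+\bar\mu I_n\big)^{-3}\,Q_1^{-1/2}(a_0-Q_0Q_1^{-1}a_1)>0.$$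
   Context: A function $h$ is strongly concave on an interval $D$ with constant $\alpha>0$ if $h(tx+(1-t)y)\ge th(x)+(1-t)h(y)+\frac{\alpha t(1-t)}2|y-x|^2$ for all $x,y\in D$ and $t\in[0,1]$. *)

(* Defs.v *)
From mathcomp Require Import all_boot all_order all_algebra.
From mathcomp Require Import all_classical all_reals ereal.

Set Implicit Arguments.
Unset Strict Implicit.
Unset Printing Implicit Defensive.

Import Order.TTheory GRing.Theory Num.Theory.

Local Open Scope classical_set_scope.
Local Open Scope ring_scope.

Definition qform (R : realType) (n : nat) (Q : 'M[R]_n) (x : 'cV[R]_n) : R :=
  (x^T *m Q *m x) 0 0.

Definition posdefmx (R : realType) (n : nat) (Q : 'M[R]_n) : Prop :=
  forall x : 'cV[R]_n, x != 0 -> 0 < qform Q x.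

Definition possemidefmx (R : realType) (n : nat) (Q : 'M[R]_n) : Prop :=
  forall x : 'cV[R]_n, 0 <= qform Q x.

(* The principal square root: a positive semidefinite symmetric matrix has
   exactly one positive semidefinite symmetric square root.  The value is 0
   when no such root exists. *)
Definition sqrtmx (R : realType) (n : nat) (Q : 'M[R]_n) : 'M[R]_n :=
  xget 0 [set S : 'M[R]_n | [/\ S^T = S, possemidefmx S & S *m S = Q]].

Definition quadfun (R : realType) (n : nat) (Q : 'M[R]_n) (a : 'cV[R]_n)
    (b : R) (x : 'cV[R]_n) : R :=
  2^-1 * qform Q x + (a^T *m x) 0 0 + b.

Section OneConstraintProblem.
Context (R : realType) (n : nat).
Implicit Types f g : 'cV[R]_n -> R.

Definition optimal_value f g : \bar R :=
  ereal_inf [set (f x)%:E | x in [set x : 'cV[R]_n | g x <= 0]].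

Definition dual_function f g (mu : R) : \bar R :=
  ereal_inf (range (fun x : 'cV[R]_n => (f x + mu * g x)%:E)).

Definition dual_solution f g (mu : R) : Prop :=
  0 <= mu /\
  forall nu : R, 0 <= nu -> (dual_function f g nu <= dual_function f g mu)%E.

End OneConstraintProblem.

Definition strongly_concave_on (R : realType) (D : interval R) (alpha : R)
    (h : R -> R) : Prop :=
  0 < alpha /\
  forall x y t : R, x \in D -> y \in D -> t \in `[0, 1] ->
    t * h x + (1 - t) * h y + alpha * t * (1 - t) / 2 * `|y - x| ^+ 2
      <= h (t * x + (1 - t) * y).

Definition strong_concavity_constant (R : realType) (n : nat)
    (Q0 Q1 : 'M[R]_n) (a0 a1 : 'cV[R]_n) (mubar : R) : R :=
  let Q1isqrt := invmx (sqrtmx Q1) in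
  let v := Q1isqrt *m (a0 - Q0 *m invmx Q1 *m a1) in
  qform (invmx (Q1isqrt *m Q0 *m Q1isqrt + mubar%:M) ^+ 3) v.

(* Main.v *)
Require Import Defs.
From mathcomp Require Import all_boot all_order all_algebra.
From mathcomp Require Import spectral sesquilinear complex ring lra.
From mathcomp Require Import all_classical all_reals ereal topology normedtype.

Import Order.TTheory GRing.Theory Num.Theory.
Import numFieldNormedType.Exports.
Local Open Scope classical_set_scope.
Local Open Scope ring_scope.

(** Both quadratic forms become sums of squares in one system of coordinates.
  Let S be the square root of Q1 and let H be an orthogonal matrix that
  diagonalizes the matrix S^-1 Q0 S^-1, so that it equals H^T diag(d) H.  Then
  P = S^-1 H^T satisfies P^T Q1 P = I and P^T Q0 P = diag(d) with d > 0
  (simultaneous_diagonalization).  After the substitution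
  x = P y - Q1^-1 a1, which also removes the linear part of the constraint
  (quadfun_affine),
    f  = 1/2 sum_i d_i y_i^2 + sum_i u_i y_i + k0,
    g1 = 1/2 sum_i y_i^2 + k1,
  where u = P^T (a0 - Q0 Q1^-1 a1) is nonzero.  Minimizing the Lagrangian
  coordinate by coordinate gives, for mu >= 0,
    theta(mu) = k0 + mu k1 - 1/2 sum_i u_i^2 / (d_i + mu),
  attained at y_i = - u_i / (d_i + mu), and the same coordinates turn the
  constant into alpha_D = sum_i u_i^2 / (d_i + mubar)^3, which is positive.

  Strong concavity is then a statement about the functions 1 / (d + mu).  For
  z = t x + (1 - t) y there is the exact formula
    t / (d + x) + (1 - t) / (d + y) - 1 / (d + z)
      = t (1 - t) (y - x)^2 / ((d + x) (d + y) (d + z)),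
  and on [0, mubar] the denominator is at most (d + mubar)^3
  (separable_dual_strongly_concave).

  A dual solution comes from the optimality conditions.  The value of g1 at the
  minimizer of the Lagrangian is continuous in mu and tends to k1 < 0, so either
  it is nonpositive at mu = 0 or it vanishes at some mu > 0
  (complementary_multiplier).  At this mu the minimizer is feasible and
  complementary, hence mu is dual optimal and there is no duality gap
  (kkt_dual_solution).  So L <= theta(mu) <= f(x0) + mu g1(x0), that is
  mu <= mubar.  Uniqueness follows from strong concavity on an interval [0, m]
  that contains both solutions. *)

(** * Orthogonal diagonalization of real symmetric matrices *)

(** Over R[i] the matrix is Hermitian, so its unitary diagonalization has real
  entries.  Such an entry is a root of the characteristic polynomial, which has
  coefficients in R, and therefore is an eigenvalue over R as well. *)
Lemma symmetric_real_eigenvalue {R : rcfType} {n : nat} {Q : 'M[R]_n.+1} :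
  Q^T = Q -> exists a : R, eigenvalue Q a.
Proof.
move=> symQ; pose A := map_mx (real_complex R) Q.
have realA : A \is a mxOver Num.real.
  by apply/mxOverP => i j; rewrite !mxE complex_real.
have hermA : A \is hermsymmx.
  apply: realsym_hermsym realA.
  by apply/is_hermitianmxP; rewrite expr0 scale1r map_mx_id// map_trmx symQ.
have /orthomx_spectralP decA := hermitian_normalmx hermA.
have /mxOverP/(_ 0 0)/complex_realP[a dE] := hermitian_spectral_diag_real hermA.
exists a; rewrite eigenvalue_root_char -(fmorph_root (real_complex R)).
rewrite map_char_poly -/A -eigenvalue_root_char.
have Pu := spectral_unit A.
apply/eigenvalueP; exists (row 0 (spectralmx A)).
  rewrite {2}decA -row_mul !mulmxA mulmxV// mul1mx row_mul row_diag_mx.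
  by rewrite -scalemxAl -rowE dE.
apply/eqP => r0; have := congr1 (row 0) (mulmxV Pu).
rewrite row_mul r0 mul0mx row1 => /rowP/(_ 0); rewrite !mxE eqxx => /eqP.
by rewrite eq_sym oner_eq0.
Qed.

(** If v differs from the first basis vector e, take for K the Householder
  reflection in the direction v - e, which maps e to v. *)
Lemma orthogonal_extension {R : rcfType} {n : nat} {v : 'rV[R]_n.+1} :
  (v *m v^T) 0 0 = 1 ->
  exists2 K : 'M[R]_n.+1, K *m K^T = 1%:M & row 0 K = v.
Proof.
move=> v1; pose e : 'rV[R]_n.+1 := delta_mx 0 0; pose u := v - e.
have [/eqP|u0] := eqVneq u 0.
  rewrite subr_eq0 => /eqP ->; exists 1%:M; first by rewrite mul1mx trmx1.
  by rewrite row1.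
pose c := (u *m u^T) 0 0.
have uu : u *m u^T = c%:M by rewrite [LHS]mx11_scalar.
have cE : c = \sum_i u 0 i ^+ 2.
  by rewrite /c mxE; apply: eq_bigr => i _; rewrite [u^T _ _]mxE expr2.
have c0 : c != 0.
  apply: contraNneq u0 => c0; apply/eqP/rowP => i; rewrite [RHS]mxE.
  have := c0; rewrite cE => /eqP; rewrite psumr_eq0; last first.
    by move=> j _; apply: sqr_ge0.
  by move=> /allP/(_ i (mem_index_enum _)) /=; rewrite sqrf_eq0 => /eqP.
have ev : (e *m v^T) 0 0 = v 0 0 by rewrite -rowE !mxE.
have ee : (e *m e^T) 0 0 = 1 by rewrite -rowE !mxE !eqxx.
have ve : (v *m e^T) 0 0 = v 0 0.
  by rewrite -[v *m _]trmxK trmx_mul trmxK mxE ev.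
have eu : (e *m u^T) 0 0 = v 0 0 - 1.
  by rewrite /u raddfB /= mulmxBr mxE [X in _ + X]mxE ev ee.
have c2 : c = 2 - 2 * v 0 0.
  have -> : c = (v *m u^T) 0 0 - (e *m u^T) 0 0.
    by rewrite /c {1}/u mulmxBl mxE [X in _ + X]mxE.
  rewrite eu /u raddfB /= mulmxBr mxE [X in _ + X - _]mxE v1 ve; ring.
pose K : 'M[R]_n.+1 := 1%:M - (2 / c) *: (u^T *m u).
have KT : K^T = K by rewrite /K raddfB /= trmx1 linearZ /= trmx_mul trmxK.
have e_K : e *m K = v.
  rewrite /K mulmxBr mulmx1 -scalemxAr mulmxA [e *m _]mx11_scalar eu.
  rewrite mul_scalar_mx scalerA.
  have -> : 2 / c * (v 0 0 - 1) = -1.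
    have -> : v 0 0 - 1 = - c / 2 by rewrite c2; field.
    by field.
  by rewrite scaleN1r opprK /u addrC subrK.
exists K; last by rewrite rowE.
rewrite KT {1}/K mulmxBl mul1mx -scalemxAl {2}/K mulmxBr mulmx1 -scalemxAr.
rewrite mulmxA -(mulmxA u^T) uu mul_mx_scalar -scalemxAl scalerA.
rewrite divfK// scaler_nat mulr2n opprD addrA subrr sub0r.
by rewrite scalerN opprK /K subrK.
Qed.

(** Induction on the dimension: in an orthonormal basis whose first vector is an
  eigenvector, symmetry makes the matrix block diagonal. *)
Lemma symmetric_diagonalization {R : rcfType} {n : nat} {Q : 'M[R]_n} :
  Q^T = Q ->
  exists H : 'M[R]_n, exists d : 'rV[R]_n,
    H *m H^T = 1%:M /\ Q = H^T *m diag_mx d *m H.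
Proof.
elim: n Q => [|n IHn] Q symQ.
  by exists 1%:M, 0; rewrite !(flatmx0 (_ *m _)) (flatmx0 Q) (flatmx0 1%:M).
have [a /eigenvalueP[w wQ w0]] := symmetric_real_eigenvalue symQ.
pose r := (w *m w^T) 0 0.
have r0 : 0 < r.
  have -> : r = \sum_i w 0 i ^+ 2.
    by rewrite /r mxE; apply: eq_bigr => i _; rewrite mxE expr2.
  rewrite lt_neqAle sumr_ge0 ?andbT; last by move=> i _; apply: sqr_ge0.
  rewrite eq_sym psumr_eq0; last by move=> i _; apply: sqr_ge0.
  apply: contraNN w0 => /allP w0; apply/eqP/rowP => i; rewrite mxE.
  by have := w0 i (mem_index_enum _); rewrite sqrf_eq0 => /eqP.
pose v := (Num.sqrt r)^-1 *: w.
have vQ : v *m Q = a *: v by rewrite -scalemxAl wQ scalerA mulrC -scalerA.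
have v1 : (v *m v^T) 0 0 = 1.
  rewrite linearZ /= -scalemxAl -scalemxAr scalerA mxE -/r -invfM -expr2.
  by rewrite sqr_sqrtr ?ltW// mulVf ?gt_eqF.
have [K KK rK] := orthogonal_extension v1.
have KTK : K^T *m K = 1%:M by apply: mulmx1C.
pose A : 'M[R]_(1 + n) := K *m Q *m K^T.
have symA : A^T = A by rewrite /A !trmx_mul trmxK symQ mulmxA.
have rA : row 0 A = a *: delta_mx 0 0.
  by rewrite /A !row_mul rK vQ -scalemxAl -rK -row_mul KK row1.
have ur0 : ursubmx A = 0.
  apply/matrixP => i j; rewrite !mxE (ord1 i).
  have /rowP/(_ (rshift 1 j)) := rA; rewrite !mxE.
  have -> : lshift n 0 = 0 :> 'I_(1 + n) by apply: val_inj.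
  by move=> ->; rewrite mulr0.
have ul : ulsubmx A = a%:M.
  apply/matrixP => i j; rewrite !mxE !ord1.
  have /rowP/(_ (lshift n 0)) := rA; rewrite !mxE.
  have -> : lshift n 0 = 0 :> 'I_(1 + n) by apply: val_inj.
  by move=> ->; rewrite !eqxx mulr1.
have dl0 : dlsubmx A = 0 by rewrite -[dlsubmx A]trmxK trmx_dlsub symA ur0 trmx0.
have [|H [d [HH dr]]] := IHn (drsubmx A); first by rewrite trmx_drsub symA.
pose G : 'M[R]_(1 + n) := block_mx 1%:M 0 0 H.
have GG : G *m G^T = 1%:M.
  rewrite tr_block_mx mulmx_block !trmx0 trmx1 !mulmx0 !mul0mx !addr0 add0r.
  by rewrite mulmx1 HH -scalar_mx_block.
have defA : A = G^T *m diag_mx (row_mx a%:M d) *m G.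
  rewrite -[LHS]submxK ur0 ul dl0 dr diag_mx_row tr_block_mx !mulmx_block.
  rewrite !(trmx0, trmx1, mulmx0, mul0mx, addr0, add0r) mul1mx mulmx1.
  congr (block_mx _ _ _ _).
  by apply/matrixP => i j; rewrite !ord1 !mxE eqxx.
exists (G *m K), (row_mx a%:M d); split.
  by rewrite trmx_mul mulmxA -(mulmxA G) KK mulmx1.
rewrite trmx_mul -!mulmxA [diag_mx _ *m _]mulmxA [G^T *m _]mulmxA.
by rewrite [G^T *m _]mulmxA -defA /A -!mulmxA KTK mulmx1 mulmxA KTK mul1mx.
Qed.

(** * Simultaneous diagonalization of two quadratic forms *)

Lemma qform_diag {R : realType} {n : nat} (d : 'rV[R]_n) (x : 'cV[R]_n) :
  qform (diag_mx d) x = \sum_i d 0 i * x i 0 ^+ 2.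
Proof.
rewrite /qform mxE; apply: eq_bigr => i _.
by rewrite mul_mx_diag !mxE mulrAC mulrC expr2.
Qed.

Lemma qform_congr {R : realType} {n : nat} (P Q : 'M[R]_n) (x : 'cV[R]_n) :
  qform (P^T *m Q *m P) x = qform Q (P *m x).
Proof. by rewrite /qform trmx_mul !mulmxA. Qed.

Lemma posdefmx_unit {R : realType} {n : nat} {Q : 'M[R]_n} :
  posdefmx Q -> Q \in unitmx.
Proof.
move=> Qpd; rewrite -row_free_unit -kermx_eq0; apply/rowV0P => v /sub_kermxP vQ.
have [//|v0] := eqVneq v 0.
have /Qpd : v^T != 0.
  by apply: contraNneq v0 => vT0; rewrite -[v]trmxK vT0 trmx0.
by rewrite /qform trmxK vQ mul0mx mxE ltxx.
Qed.

Lemma posdefmx_congr {R : realType} {n : nat} {P Q : 'M[R]_n} :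
  P \in unitmx -> posdefmx Q -> posdefmx (P^T *m Q *m P).
Proof.
move=> Pu Qpd x x0; rewrite qform_congr; apply: Qpd.
by apply: contraNneq x0 => Px0; rewrite -[x](mulKmx Pu) Px0 mulmx0.
Qed.

Lemma posdefmx_diag_gt0 {R : realType} {n : nat} {d : 'rV[R]_n} :
  posdefmx (diag_mx d) -> forall i, 0 < d 0 i.
Proof.
move=> dpd i; have := dpd (delta_mx i 0).
rewrite qform_diag (bigD1 i)//= mxE !eqxx expr1n mulr1 big1 => [|j ji].
  rewrite addr0; apply; apply/eqP => /colP/(_ i); rewrite !mxE !eqxx => /eqP.
  by rewrite oner_eq0.
by rewrite mxE (negPf ji) expr0n mulr0.
Qed.

Lemma posdefmx_diagonalization {R : realType} {n : nat} {Q : 'M[R]_n} :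
  Q^T = Q -> posdefmx Q ->
  exists H : 'M[R]_n, exists d : 'rV[R]_n,
    [/\ H *m H^T = 1%:M, Q = H^T *m diag_mx d *m H & forall i, 0 < d 0 i].
Proof.
move=> /symmetric_diagonalization[H [d [HH QE]]] Qpd; exists H, d; split=> //.
apply: posdefmx_diag_gt0.
have -> : diag_mx d = H^T^T *m Q *m H^T.
  by rewrite QE trmxK !mulmxA HH mul1mx -mulmxA HH mulmx1.
by apply: posdefmx_congr Qpd; case/mulmx1_unit: HH.
Qed.

(** The spectral decomposition Q = H^T diag(d) H provides the positive
  semidefinite root H^T diag(sqrt d) H, so that sqrtmx is not its default. *)
Lemma sqrtmx_symmetric_root {R : realType} {n : nat} {Q : 'M[R]_n} :
  Q^T = Q -> posdefmx Q ->
  (sqrtmx Q)^T = sqrtmx Q /\ sqrtmx Q *m sqrtmx Q = Q.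
Proof.
move=> symQ /(posdefmx_diagonalization symQ)[H [d [HH QE d0]]].
rewrite /sqrtmx; case: xgetP => [S _ [-> _ SS] //|noS].
pose r : 'rV[R]_n := \row_i Num.sqrt (d 0 i).
exfalso; apply: (noS (H^T *m diag_mx r *m H)); split.
- by rewrite !trmx_mul trmxK tr_diag_mx mulmxA.
- move=> x; rewrite qform_congr qform_diag; apply: sumr_ge0 => i _.
  by rewrite mulr_ge0 ?sqr_ge0// mxE sqrtr_ge0.
rewrite QE !mulmxA -(mulmxA _ H) HH mulmx1; congr (_ *m H).
rewrite -!mulmxA; congr (_ *m _); apply/matrixP => i j.
rewrite mul_diag_mx !mxE mulrnAr -expr2 sqr_sqrtr ?ltW//.
Qed.

(** Let S be the root of Q1, T = S^-1, and let H be orthogonal with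
  T Q0 T = H^T diag(d) H.  Then P = T H^T works.  Moreover C = T Q0 T + m I is
  H^T diag(d_i + m) H and H T w = P^T w, hence the constant w^T T C^-3 T w is a
  weighted sum of squares of the entries of P^T w.  It is computed here because
  it is written in terms of S, of which only P survives. *)
Lemma simultaneous_diagonalization {R : realType} {n : nat} {Q0 Q1 : 'M[R]_n} :
  Q0^T = Q0 -> Q1^T = Q1 -> posdefmx Q0 -> posdefmx Q1 ->
  exists P : 'M[R]_n, exists d : 'rV[R]_n,
    [/\ P \in unitmx, P^T *m Q1 *m P = 1%:M, P^T *m Q0 *m P = diag_mx d,
        forall i, 0 < d 0 i
      & forall a0 a1 m, 0 <= m ->
        strong_concavity_constant Q0 Q1 a0 a1 m =
        \sum_i (P^T *m (a0 - Q0 *m invmx Q1 *m a1)) i 0 ^+ 2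
               / (d 0 i + m) ^+ 3].
Proof.
move=> sym0 sym1 pd0 pd1.
have [symS SS] := sqrtmx_symmetric_root sym1 pd1.
rewrite /strong_concavity_constant; move: (sqrtmx Q1) symS SS => S symS SS.
have Su : S \in unitmx.
  by have := posdefmx_unit pd1; rewrite -SS unitmx_mul andbb.
pose T := invmx S; have symT : T^T = T by rewrite /T trmx_inv symS.
have Tu : T \in unitmx by rewrite unitmx_inv.
have TQ1 : T *m Q1 *m T = 1%:M by rewrite -SS mulmxA mulVmx// mul1mx mulmxV.
have symC : (T *m Q0 *m T)^T = T *m Q0 *m T.
  by rewrite !trmx_mul symT sym0 mulmxA.
have pdC : posdefmx (T *m Q0 *m T) by rewrite -{1}symT; apply: posdefmx_congr.
have [H [d [HH CE d0]]] := posdefmx_diagonalization symC pdC.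
have HTH : H^T *m H = 1%:M by apply: mulmx1C.
exists (T *m H^T), d.
have conj (Q : 'M[R]_n) :
    (T *m H^T)^T *m Q *m (T *m H^T) = H *m (T *m Q *m T) *m H^T.
  by rewrite trmx_mul trmxK symT !mulmxA.
split=> //.
- by rewrite unitmx_mul Tu; case/mulmx1_unit: HH.
- by rewrite conj TQ1 mulmx1.
- by rewrite conj CE !mulmxA HH mul1mx -mulmxA HH mulmx1.
move=> a0 a1 m m0; set w := a0 - _.
pose q k : 'rV[R]_n := \row_i (d 0 i + m) ^- k.
have dm i : d 0 i + m != 0 by rewrite gt_eqF// ltr_pwDl.
have qM j k : (H^T *m diag_mx (q j) *m H) *m (H^T *m diag_mx (q k) *m H) =
    H^T *m diag_mx (q (j + k)%N) *m H.
  rewrite !mulmxA -(mulmxA _ H) HH mulmx1; congr (_ *m H).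
  rewrite -!mulmxA; congr (_ *m _); rewrite mulmx_diag; congr diag_mx.
  by apply/rowP => i; rewrite !mxE -invfM -exprD.
have -> : invmx (T *m Q0 *m T + m%:M) = H^T *m diag_mx (q 1%N) *m H.
  have inv : (T *m Q0 *m T + m%:M) *m (H^T *m diag_mx (q 1%N) *m H) = 1%:M.
    have -> : T *m Q0 *m T + m%:M = H^T *m (diag_mx d + m%:M) *m H.
      rewrite CE mulmxDr mulmxDl; congr (_ + _).
      by rewrite mul_mx_scalar -scalemxAl HTH scalemx1.
    rewrite !mulmxA -(mulmxA _ H) HH mulmx1 -(mulmxA H^T).
    suff -> : (diag_mx d + m%:M) *m diag_mx (q 1%N) = 1%:M.
      by rewrite mulmx1.
    apply/matrixP => i j; rewrite mulmxDl mul_diag_mx mul_scalar_mx !mxE.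
    case: eqP => [->|_]; rewrite ?mulr0n ?mulr0 ?addr0//.
    by rewrite mulr1n expr1 -mulrDl mulfV.
  have Cu : T *m Q0 *m T + m%:M \in unitmx by case/mulmx1_unit: inv.
  by rewrite -[RHS](mulKmx Cu) inv mulmx1.
have -> : (H^T *m diag_mx (q 1%N) *m H) ^+ 3 = H^T *m diag_mx (q 3%N) *m H.
  by rewrite 2!exprS expr1 -!mulmxE !qM.
rewrite qform_congr qform_diag trmx_mul trmxK symT -mulmxA.
by apply: eq_bigr => i _; rewrite mxE mulrC.
Qed.

(** Completion of the square: for c = Q^-1 a the new linear term vanishes. *)
Lemma quadfun_affine {R : realType} {n : nat} (Q P : 'M[R]_n)
    (a c y : 'cV[R]_n) (b : R) :
  Q^T = Q ->
  quadfun Q a b (P *m y - c) =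
  2^-1 * qform (P^T *m Q *m P) y + ((P^T *m (a - Q *m c))^T *m y) 0 0
    + quadfun Q a b (- c).
Proof.
move=> symQ; rewrite qform_congr trmx_mul trmxK -mulmxA.
move: (P *m y) => z; rewrite /quadfun /qform.
have cross : (c^T *m Q *m z) 0 0 = (z^T *m Q *m c) 0 0.
  by rewrite -[z^T *m Q *m c]trmxK [RHS]mxE !trmx_mul trmxK symQ mulmxA.
have subE (A B : 'M[R]_1) : (A - B) 0 0 = A 0 0 - B 0 0 by rewrite !mxE.
have oppE (A : 'M[R]_1) : (- A) 0 0 = - A 0 0 by rewrite !mxE.
have trB (A B : 'cV[R]_n) : (A - B)^T = A^T - B^T.
  by apply/matrixP => i j; rewrite !mxE.
have trN (A : 'cV[R]_n) : (- A)^T = - A^T by apply/matrixP => i j; rewrite !mxE.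
have -> : (z - c)^T *m Q *m (z - c) =
    (z^T *m Q *m z - z^T *m Q *m c) - (c^T *m Q *m z - c^T *m Q *m c).
  by rewrite trB !mulmxBl !mulmxBr.
have -> : (- c)^T *m Q *m (- c) = c^T *m Q *m c.
  by rewrite trN !mulNmx mulmxN opprK.
have -> : (a - Q *m c)^T *m z = a^T *m z - c^T *m Q *m z.
  by rewrite trB trmx_mul symQ mulmxBl.
rewrite mulmxBr mulmxN !(subE, oppE) cross; lra.
Qed.

(** * Duality for one constraint *)

Lemma dual_function_le {R : realType} {n : nat} (f g : 'cV[R]_n -> R) mu x :
  (dual_function f g mu <= (f x + mu * g x)%:E)%E.
Proof. by apply: ereal_inf_lbound; exists x. Qed.

Lemma dual_function_attained {R : realType} {n : nat} {f g : 'cV[R]_n -> R}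
    {mu : R} (x : 'cV[R]_n) :
  (forall z, f x + mu * g x <= f z + mu * g z) ->
  dual_function f g mu = (f x + mu * g x)%:E.
Proof.
move=> xmin; apply/le_anti; rewrite dual_function_le /=.
by apply: le_ereal_inf_tmp => _ [z _ <-]; rewrite lee_fin.
Qed.

(** Complementary slackness makes the dual value equal to f x, with x feasible;
  weak duality at x bounds every other dual value by f x. *)
Lemma kkt_dual_solution {R : realType} {n : nat} {f g : 'cV[R]_n -> R}
    {mu : R} {x : 'cV[R]_n} :
  0 <= mu -> g x <= 0 -> mu * g x = 0 ->
  dual_function f g mu = (f x + mu * g x)%:E ->
  dual_solution f g mu /\ (optimal_value f g <= dual_function f g mu)%E.
Proof.
move=> mu0 gx0 slack dualE; rewrite /dual_solution dualE slack addr0.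
split; last by apply: ereal_inf_lbound; exists x.
split=> // nu nu0; apply: le_trans (dual_function_le f g nu x) _.
by rewrite lee_fin gerDl mulr_ge0_le0.
Qed.

(** At the midpoint of two distinct maximizers the value would be larger. *)
Lemma strongly_concave_argmax_unique {R : realType} {m alpha : R} {h : R -> R} :
  strongly_concave_on `[0, m] alpha h ->
  forall x y, x \in `[0, m] -> y \in `[0, m] ->
  (forall z, 0 <= z -> h z <= h x) -> h y = h x -> y = x.
Proof.
move=> [alpha0 hconc] x y xm ym xmax yx; have [//|neq] := eqVneq y x.
have half : 2^-1 \in `[0, 1 : R] by rewrite in_itv /=; apply/andP; split; lra.
have := hconc x y _ xm ym half; rewrite yx => /le_trans gap.
have mid0 : 0 <= 2^-1 * x + (1 - 2^-1) * y.
  by move: xm ym; rewrite !in_itv /= => /andP[? _] /andP[? _]; lra.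
have := gap _ (xmax _ mid0).
have dist0 : 0 < `|y - x| ^+ 2 by rewrite exprn_gt0// normr_gt0 subr_eq0.
have : 0 < alpha * `|y - x| ^+ 2 by rewrite mulr_gt0.
move: (`|y - x| ^+ 2) => D; nra.
Qed.

(** * The separable dual problem *)

(** When every d_i + mu is positive, the minimum over y of the Lagrangian
  1/2 sum_i d_i y_i^2 + sum_i u_i y_i + k0 + mu (1/2 sum_i y_i^2 + k1). *)
Definition separable_dual {R : realFieldType} {n : nat} (d u : 'I_n -> R)
    (k0 k1 mu : R) : R :=
  k0 + mu * k1 - 2^-1 * \sum_i u i ^+ 2 / (d i + mu).

(** Completing the square in each coordinate of the Lagrangian; it shows at once
  that separable_dual is a lower bound and where it is attained. *)
Lemma separable_lagrangian_square {R : realFieldType} {n : nat}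
    {d u : 'I_n -> R} {k0 k1 mu : R} (y : 'I_n -> R) :
  (forall i, 0 < d i + mu) ->
  separable_dual d u k0 k1 mu +
    2^-1 * \sum_i (d i + mu) * (y i + u i / (d i + mu)) ^+ 2 =
  (2^-1 * (\sum_i d i * y i ^+ 2) + (\sum_i u i * y i) + k0)
    + mu * (2^-1 * (\sum_i y i ^+ 2) + k1).
Proof.
move=> dmu; rewrite /separable_dual.
suff -> : \sum_i (d i + mu) * (y i + u i / (d i + mu)) ^+ 2 =
    \sum_i d i * y i ^+ 2 + mu * (\sum_i y i ^+ 2) + 2 * (\sum_i u i * y i)
      + \sum_i u i ^+ 2 / (d i + mu) by lra.
rewrite !mulr_sumr -!big_split /=; apply: eq_bigr => i _.
by field; rewrite gt_eqF.
Qed.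

(** With z = t x + (1 - t) y, the concavity gap of - 1 / (d + mu) is exactly
  t (1 - t) (y - x)^2 / ((d + x) (d + y) (d + z)), and each factor of the
  denominator is at most d + m. *)
Lemma separable_dual_strongly_concave {R : realFieldType} {n : nat}
    {d u : 'I_n -> R} {k0 k1 m x y t : R} :
  (forall i, 0 < d i) ->
  x \in `[0, m] -> y \in `[0, m] -> t \in `[0, 1] ->
  t * separable_dual d u k0 k1 x + (1 - t) * separable_dual d u k0 k1 y
    + (\sum_i u i ^+ 2 / (d i + m) ^+ 3) * t * (1 - t) / 2 * `|y - x| ^+ 2
  <= separable_dual d u k0 k1 (t * x + (1 - t) * y).
Proof.
rewrite !in_itv /= => d0 /andP[x0 xm] /andP[y0 ym] /andP[t0 t1].
rewrite /separable_dual real_normK ?num_real//; set z := t * x + (1 - t) * y.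
have z0 : 0 <= z by rewrite /z addr_ge0// mulr_ge0// subr_ge0.
have zm : z <= m by rewrite /z; nra.
suff : 0 <= t * (\sum_i u i ^+ 2 / (d i + x))
    + (1 - t) * (\sum_i u i ^+ 2 / (d i + y)) - \sum_i u i ^+ 2 / (d i + z)
    - (t * (1 - t) * (y - x) ^+ 2) * \sum_i u i ^+ 2 / (d i + m) ^+ 3.
  rewrite /z; lra.
rewrite !mulr_sumr -big_split -!sumrB /=; apply: sumr_ge0 => i _.
have dx : 0 < d i + x by rewrite ltr_pwDl.
have dy : 0 < d i + y by rewrite ltr_pwDl.
have dz : 0 < d i + z by rewrite ltr_pwDl.
have dm : 0 < d i + m by rewrite ltr_pwDl// (le_trans x0).
have -> : t * (u i ^+ 2 / (d i + x)) + (1 - t) * (u i ^+ 2 / (d i + y))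
    - u i ^+ 2 / (d i + z)
    - t * (1 - t) * (y - x) ^+ 2 * (u i ^+ 2 / (d i + m) ^+ 3) =
    t * (1 - t) * (y - x) ^+ 2 * u i ^+ 2 *
    (((d i + x) * (d i + y) * (d i + z))^-1 - ((d i + m) ^+ 3)^-1).
  rewrite [RHS]mulrBr [X in _ - X = _]mulrA; congr (_ - _).
  by rewrite /z; field; rewrite -/z !gt_eqF.
apply: mulr_ge0.
  by rewrite -mulrA -exprMn mulr_ge0 ?sqr_ge0// mulr_ge0 ?subr_ge0.
rewrite subr_ge0 lef_pV2 ?posrE ?exprn_gt0 ?mulr_gt0//.
have pM := ltW (mulr_gt0 dx dy).
have := ler_pM (ltW dx) (ltW dy)
  (_ : d i + x <= d i + m) (_ : d i + y <= d i + m).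
rewrite !lerD2l => /(_ xm ym) xym.
have := ler_pM pM (ltW dz) xym (_ : d i + z <= d i + m).
by rewrite lerD2l => /(_ zm) /le_trans; apply; rewrite !exprS expr0 mulr1 mulrA.
Qed.

(** Here s mu is the value of the constraint at the minimizer of the Lagrangian.
  If s 0 <= 0, the unconstrained minimizer is feasible and the multiplier 0 will
  do.  Otherwise s falls from a positive value towards k < 0, and it vanishes in
  between by the intermediate value theorem. *)
Lemma complementary_multiplier {R : realType} {n : nat} {d u : 'I_n -> R}
    {k : R} :
  (forall i, 0 < d i) -> k < 0 ->
  let s mu := 2^-1 * (\sum_i (u i / (d i + mu)) ^+ 2) + k in
  exists mu, [/\ 0 <= mu, s mu <= 0 & mu * s mu = 0].
Proof.
move=> d0 k0 s; have [s0|s0] := leP (s 0) 0.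
  by exists 0; rewrite lexx mul0r.
pose U := \sum_i u i ^+ 2.
have U0 : 0 <= U by apply: sumr_ge0 => i _; apply: sqr_ge0.
(* For mu >= 1 the sum of squares is at most U / mu, and U / M <= - k. *)
pose M : R := 1 - U / k; have M1 : 1 <= M.
  by rewrite lerDl oppr_ge0 ler_ndivrMr// mul0r.
have sM : s M <= 0.
  have : \sum_i (u i / (d i + M)) ^+ 2 <= U / M.
    rewrite /U mulr_suml; apply: ler_sum => i _.
    rewrite exprMn ler_wpM2l ?sqr_ge0// exprVn lef_pV2 ?posrE; last 2 first.
    - by rewrite exprn_gt0// ltr_pwDl// (le_trans _ M1).
    - by rewrite (lt_le_trans _ M1).
    by have := d0 i; nra.
  have : U / M <= - k.
    rewrite ler_pdivrMr ?(lt_le_trans _ M1)// /M mulrBr mulr1 mulNr opprK.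
    by rewrite mulrCA divff ?lt_eqF// mulr1 lerDr oppr_ge0 ltW.
  by rewrite /s; lra.
have cont : {within `[0, M], continuous s}.
  apply: continuous_in_subspaceT => x; rewrite inE /= in_itv /= => /andP[x0 _].
  apply: cvgD; last exact: cvg_cst.
  apply: cvgM; first exact: cvg_cst.
  apply: (@cvg_big _ _ +%R 0 _ add_continuous) => i _.
  have inv : (u i / (d i + mu) @[mu --> x] --> u i / (d i + x)).
    apply: cvgM; first exact: cvg_cst.
    apply: cvgV; first by rewrite gt_eqF// ltr_pwDl.
    by apply: cvgD; [exact: cvg_cst|exact: cvg_id].
  exact: (cvgM inv inv).
have [|mu muM smu] := IVT (le_trans ler01 M1) cont (v := 0).
  by rewrite ge_min le_max sM (ltW s0) orbT.
exists mu; rewrite smu mulr0 lexx; split=> //.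
by move: muM; rewrite in_itv /= => /andP[].
Qed.

(** The completed squares vanish exactly at y_i = - u_i / (d_i + mu), whose
  image under phi is therefore the minimizer of the Lagrangian. *)
Lemma separable_lagrangian_minimizer {R : realType} {n : nat} {d u : 'I_n -> R}
    {k0 k1 : R} {f g : 'cV[R]_n -> R} {phi : 'cV[R]_n -> 'cV[R]_n} {mu : R} :
  (forall x, exists y, x = phi y) ->
  (forall y, f (phi y) =
     2^-1 * (\sum_i d i * y i 0 ^+ 2) + (\sum_i u i * y i 0) + k0) ->
  (forall y, g (phi y) = 2^-1 * (\sum_i y i 0 ^+ 2) + k1) ->
  (forall i, 0 < d i + mu) ->
  exists2 x, g x = 2^-1 * (\sum_i (u i / (d i + mu)) ^+ 2) + k1 &
    dual_function f g mu = (f x + mu * g x)%:E /\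
    f x + mu * g x = separable_dual d u k0 k1 mu.
Proof.
move=> phi_surj fE gE dmu.
pose y : 'cV[R]_n := \col_i (- (u i / (d i + mu))).
have valE : f (phi y) + mu * g (phi y) = separable_dual d u k0 k1 mu.
  rewrite fE gE -(separable_lagrangian_square (fun i => y i 0) dmu).
  rewrite big1 ?mulr0 ?addr0// => i _.
  by rewrite mxE addNr expr0n mulr0.
exists (phi y).
  by rewrite gE; congr (_ * _ + _); apply: eq_bigr => i _; rewrite mxE sqrrN.
split=> //; apply: dual_function_attained => x; rewrite valE.
have [z ->] := phi_surj x.
rewrite fE gE -(separable_lagrangian_square (fun i => z i 0) dmu) lerDl.
rewrite mulr_ge0// sumr_ge0// => i _.
by rewrite mulr_ge0 ?sqr_ge0// ltW.
Qed.

Theorem proposition2p8 (R : realType) (n : nat) (Q0 Q1 : 'M[R]_n)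
    (a0 a1 : 'cV[R]_n) (b0 b1 : R) (x0 : 'cV[R]_n) (L : R) :
  let f := quadfun Q0 a0 b0 in
  let g1 := quadfun Q1 a1 b1 in
  let theta := dual_function f g1 in
  let mubar := (L - f x0) / g1 x0 in
  let alphaD := strong_concavity_constant Q0 Q1 a0 a1 mubar in
  Q0^T = Q0 -> Q1^T = Q1 ->
  posdefmx Q0 -> posdefmx Q1 ->
  g1 x0 < 0 ->
  a0 != Q0 *m invmx Q1 *m a1 ->
  (L%:E <= optimal_value f g1)%E ->
  [/\ 0 <= mubar,
      exists mu : R, [/\ dual_solution f g1 mu,
                         forall nu : R, dual_solution f g1 nu -> nu = mu
                       & mu \in `[0, mubar]],
      forall mu : R, 0 <= mu -> theta mu \is a fin_num,
      0 < alphaD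
    & strongly_concave_on `[0, mubar] alphaD (fun mu => fine (theta mu))].
Proof.
move=> f g1 theta mubar alphaD sym0 sym1 pd0 pd1 slater ane Lopt.
have [P [d [Pu PQ1 PQ0 d0 alphaE]]] :=
  simultaneous_diagonalization sym0 sym1 pd0 pd1.
pose c := invmx Q1 *m a1; pose w := a0 - Q0 *m invmx Q1 *m a1.
pose u i := (P^T *m w) i 0; pose phi y := P *m y - c.
have phi_surj x : exists y, x = phi y.
  by exists (invmx P *m (x + c)); rewrite /phi mulKVmx// addrK.
have fE y : f (phi y) = 2^-1 * (\sum_i d 0 i * y i 0 ^+ 2)
    + (\sum_i u i * y i 0) + f (- c).
  rewrite /f quadfun_affine// PQ0 qform_diag mulmxA -/w.
  by congr (_ + _ + _); rewrite mxE; apply: eq_bigr => i _; rewrite mxE.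
have gE y : g1 (phi y) = 2^-1 * (\sum_i y i 0 ^+ 2) + g1 (- c).
  rewrite /g1 quadfun_affine// PQ1 mulKVmx ?posdefmx_unit// subrr mulmx0 trmx0.
  rewrite mul0mx [X in _ + X + _]mxE addr0 /qform mulmx1 mxE.
  by congr (_ * _ + _); apply: eq_bigr => i _; rewrite mxE expr2.
have k1_lt0 : g1 (- c) < 0.
  apply: le_lt_trans slater; have [y ->] := phi_surj x0.
  by rewrite gE lerDr mulr_ge0// sumr_ge0// => i _; apply: sqr_ge0.
pose tau := separable_dual (d 0) u (f (- c)) (g1 (- c)).
have minim mu (mu0 : 0 <= mu) : exists2 x,
    g1 x = 2^-1 * (\sum_i (u i / (d 0 i + mu)) ^+ 2) + g1 (- c) &
    theta mu = (f x + mu * g1 x)%:E /\ f x + mu * g1 x = tau mu.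
  apply: (separable_lagrangian_minimizer phi_surj fE gE) => i.
  by rewrite ltr_pwDl.
have thetaE mu : 0 <= mu -> theta mu = (tau mu)%:E.
  by move=> /minim[x _ [-> ->]].
have alpha_gt0 m : 0 <= m -> 0 < strong_concavity_constant Q0 Q1 a0 a1 m.
  move=> m0; rewrite alphaE// -/w.
  have term_ge0 i : 0 <= (P^T *m w) i 0 ^+ 2 / (d 0 i + m) ^+ 3.
    by rewrite divr_ge0 ?sqr_ge0// exprn_ge0// ltW// ltr_pwDl.
  rewrite lt_neqAle sumr_ge0// andbT eq_sym psumr_eq0//.
  apply: contraNN ane => /allP zero; rewrite -subr_eq0 -/w.
  have PTu : P^T \in unitmx by rewrite unitmx_tr.
  rewrite -[w](mulKmx PTu); apply/eqP; suff -> : P^T *m w = 0 by rewrite mulmx0.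
  apply/colP => i; rewrite [RHS]mxE; have := zero i (mem_index_enum _).
  rewrite /= mulf_eq0 invr_eq0 !expf_eq0 /= => /orP[/eqP//|].
  by rewrite gt_eqF// ltr_pwDl.
have concave m : 0 <= m -> strongly_concave_on `[0, m]
    (strong_concavity_constant Q0 Q1 a0 a1 m) (fun mu => fine (theta mu)).
  move=> m0; split; first exact: alpha_gt0.
  move=> x y t xm ym t01.
  have [x_ge0 y_ge0] : 0 <= x /\ 0 <= y.
    by move: xm ym; rewrite !in_itv /= => /andP[? _] /andP[? _].
  have z0 : 0 <= t * x + (1 - t) * y.
    move: t01; rewrite in_itv /= => /andP[? ?].
    by rewrite addr_ge0// mulr_ge0// subr_ge0.
  rewrite !thetaE// alphaE//=.
  exact: separable_dual_strongly_concave d0 xm ym t01.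
have feas_le x : g1 x <= 0 -> (L%:E <= (f x)%:E)%E.
  by move=> gx; apply: le_trans Lopt _; apply: ereal_inf_lbound; exists x.
have mubar_ge0 : 0 <= mubar.
  rewrite /mubar mulr_le0 ?invr_le0 ?(ltW slater)// subr_le0 -lee_fin.
  exact/feas_le/ltW.
have [mu [mu0 smu slack]] := complementary_multiplier d0 k1_lt0 (u := u).
have [xs gxs [thetaxs _]] := minim mu mu0.
rewrite -gxs in smu slack.
have [sol strong] := kkt_dual_solution mu0 smu slack thetaxs.
split=> //.
- exists mu; split=> // [nu [nu0 nuopt]|].
    have [_ muopt] := sol.
    (* mu + nu is an endpoint beyond both solutions: nu may exceed mubar. *)
    have m0 : 0 <= mu + nu by rewrite addr_ge0.
    apply: (strongly_concave_argmax_unique (concave _ m0)).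
    + by rewrite in_itv /= mu0 lerDl.
    + by rewrite in_itv /= nu0 lerDr.
    + by move=> z z0; rewrite -lee_fin !fineK ?thetaE//= -!thetaE// muopt.
    + by congr fine; apply/le_anti; rewrite muopt//= nuopt.
  rewrite in_itv /= mu0 /mubar ler_ndivlMr//.
  have := le_trans Lopt (le_trans strong (dual_function_le f g1 mu x0)).
  by rewrite lee_fin; lra.
- by move=> nu nu0; rewrite thetaE.
- exact: alpha_gt0.
- exact: concave.
Qed.
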